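(* For any prime power $q$, there exists an intersecting $(q+2)$-Ryser hypergraph.
   Context: A hypergraph is a family of subsets (edges) of a vertex set. It is $r$-uniform if every edge has $r$ vertices. It is $r$-partite if its vertex set can be partitioned into $r$ sets (sides) so that every edge contains at most one vertex from each side. A cover is a set of vertices meeting every edge; $\tau(\mathcal H)$ is the minimum size of a cover. $\nu(\mathcal H)$ is the maximum number of pairwise disjoint edges. A hypergraph is intersecting if $\nu(\mathcal H)=1$. An $r$-Ryser hypergraph is an $r$-partite $r$-uniform hypergraph $\mathcal H$ with $\tau(\mathcal H)=(r-1)\nu(\mathcal H)$. *)

(* Defs.v *)
From mathcomp Require Import all_boot.

Set Implicit Arguments.
Unset Strict Implicit.
Unset Printing Implicit Defensive.

Definition prime_power (q : nat) : Prop :=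
  exists p k : nat, [/\ prime p, 0 < k & q = p ^ k].

Section Hypergraph.

Variable V : finType.

(* A hypergraph on V is its edge set. *)
Implicit Type H : {set {set V}}.

Definition uniform (r : nat) H : Prop := forall e, e \in H -> #|e| = r.

(* partition asks the sides to be nonempty. This loses nothing for an
   r-uniform H with an edge, since that edge then meets all r sides. *)
Definition partite (r : nat) H : Prop :=
  exists P : {set {set V}},
    [/\ partition P [set: V], #|P| = r &
        forall e S, e \in H -> S \in P -> #|e :&: S| <= 1].

Definition is_vertex_cover H (C : {set V}) : bool :=
  [forall e in H, C :&: e != set0].

(* setT is a cover unless set0 is an edge, in which case there are no covers
   and tau H has the default value #|V|. *)
Definition tau H : nat :=
  #|[arg min_(C < [set: V] | is_vertex_cover H C) #|C| ]|.

Definition is_matching H (M : {set {set V}}) : bool :=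
  (M \subset H) && trivIset M.

Definition nu H : nat := \max_(M : {set {set V}} | is_matching H M) #|M|.

Definition intersecting H : Prop := nu H = 1.

Definition ryser (r : nat) H : Prop :=
  [/\ partite r H, uniform r H & tau H = (r - 1) * nu H].

End Hypergraph.

(* Main.v *)
(** Remove a point from the projective plane of order [q]; the lines through it
    become [q + 1] sides of [q] points, and the [q ^ 2] remaining lines are
    edges. Its only covers of size [q] are the sides. Fix an edge [L], with
    point [p_s] on side [s]. Add one more side, whose vertices colour the lines:
    a line other than [L] gets the index [s] of the unique [p_s] on it, and [L]
    gets a colour of its own. Each colour class has less than [q] lines, so a
    cover of size [q] has to consist of points of the plane, hence to be a side.
    The additional edges [E_s], obtained from [L] by replacing [p_s] with a new
    vertex of side [s] and taking the colour [s], meet every line and each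
    other, and [E_s] avoids the old points of side [s]. *)

Require Import Defs.
From mathcomp Require Import all_boot all_algebra all_field.
From mathcomp Require Import ring zify.

Set Implicit Arguments.
Unset Strict Implicit.
Unset Printing Implicit Defensive.

Import GRing.Theory.

(** * Criteria for the values of [nu] and [tau] *)

Section Hypergraphs.

Variables (V : finType) (H : {set {set V}}).

Lemma nu_eq1 :
    H != set0 -> (forall e f, e \in H -> f \in H -> e :&: f != set0) ->
  nu H = 1.
Proof.
move=> /set0Pn[e0 He0] meet; apply/eqP; rewrite eqn_leq; apply/andP; split.
  apply/bigmax_leqP => M /andP[/subsetP sMH /trivIsetP tM].
  apply/card_le1_eqP => e f Me Mf; apply/eqP; apply: contraT => ef.
  have := meet _ _ (sMH _ Me) (sMH _ Mf).
  by rewrite setI_eq0 tM // eq_sym.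
rewrite -(cards1 e0) /nu; apply: (bigmax_sup [set e0]) => //.
rewrite /is_matching sub1set He0; apply/trivIsetP => e f.
by rewrite !inE => /eqP-> /eqP->; rewrite eqxx.
Qed.

Lemma tau_eq (n : nat) (C : {set V}) :
    is_vertex_cover H C -> #|C| = n ->
    (forall D, is_vertex_cover H D -> n <= #|D|) ->
  tau H = n.
Proof.
move=> HC <- minC; rewrite /tau; case: arg_minnP => [|D HD minD].
  (* Since [C] meets every edge, no edge is empty, so [setT] is a cover and [tau] is not at its
     default value. *)
  apply/forall_inP => e He; rewrite setTI.
  have /forall_inP/(_ e He) := HC.
  by apply: contraNneq => ->; rewrite setI0.
by apply/eqP; rewrite eqn_leq minC // minD.
Qed.

End Hypergraphs.

Section Transversals.

Variables S A : finType.

(** The sides are the fibres of the first projection, so graphs of functions meet each side exactly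
    once. *)
Definition transversal_edge (f : S -> A) : {set S * A} := [set (i, f i) | i : S].

Lemma in_transversal_edge f v : (v \in transversal_edge f) = (f v.1 == v.2).
Proof.
case: v => i a /=; apply/imsetP/eqP => [[j _ [-> ->]] //|<-].
by exists i.
Qed.

Lemma transversal_edge_meet f g i :
  f i = g i -> transversal_edge f :&: transversal_edge g != set0.
Proof.
move=> fg; apply/set0Pn; exists (i, f i).
by rewrite inE !in_transversal_edge /= fg eqxx.
Qed.

Variables (a0 : A) (H : {set {set S * A}}).
Hypothesis HE : forall e, e \in H -> exists f, e = transversal_edge f.

Lemma transversal_uniform : uniform #|S| H.
Proof.
move=> e /HE[f ->]; rewrite card_imset // => i j; by case.
Qed.

Lemma transversal_partite : partite #|S| H.
Proof.
pose side (i : S) : {set S * A} := [set v | v.1 == i].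
have side_inj : injective side.
  move=> i j /setP/(_ (i, a0)); rewrite !inE eqxx /=.
  by move/esym/eqP.
exists [set side i | i : S]; split.
- apply/and3P; split.
  + rewrite cover_imset; apply/eqP/setP => v; rewrite in_setT.
    by apply/bigcupP; exists v.1; rewrite ?inE.
  + apply/trivIsetP => _ _ /imsetP[i _ ->] /imsetP[j _ ->] ij.
    rewrite -setI_eq0; apply/eqP/setP => v; rewrite !inE.
    by apply/negbTE; apply: contra ij => /andP[/eqP<- /eqP<-].
  + by apply/imsetP => -[i _ /setP/(_ (i, a0))]; rewrite !inE eqxx.
- by rewrite card_imset.
move=> e T /HE[f ->] /imsetP[i _ ->]; apply/card_le1_eqP => -[j a] [k b].
rewrite !inE !in_transversal_edge /=.
by move=> /andP[/eqP<- /eqP->] /andP[/eqP<- /eqP->].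
Qed.

End Transversals.

Lemma leq_card_bigcup (V L : finType) (N : V -> {set L}) (q : nat) (C : {set V}) :
  (forall v, #|N v| <= q) -> #|\bigcup_(v in C) N v| <= q * #|C|.
Proof.
move=> Nq; rewrite mulnC -sum_nat_const.
elim/big_rec2: _ => [|v n U _ leUn]; first by rewrite cards0.
by rewrite (leq_trans (leq_card_setU _ _)) // leq_add.
Qed.

(** A deficit of [D] persists in [C], as each further vertex adds at most [q]. *)
Lemma ltn_card_bigcup (V L : finType) (N : V -> {set L}) (q : nat) (C D : {set V}) :
    (forall v, #|N v| <= q) -> D \subset C ->
    #|\bigcup_(v in D) N v| < q * #|D| ->
  #|\bigcup_(v in C) N v| < q * #|C|.
Proof.
move=> Nq DC ltD; rewrite -(cardsID D C) -{1}(setID C D) (setIidPr DC).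
rewrite bigcup_setU mulnDr.
apply: leq_ltn_trans (leq_card_setU _ _) _.
by rewrite -addSn leq_add ?leq_card_bigcup.
Qed.

(** * Coordinates on the projective plane without a point *)

Section Construction.

Variable F : finFieldType.

Let line : finType := (F * F)%type.
Let pside : finType := option F.
Let side : finType := option pside.

Implicit Types (l : line) (s t : pside).

(* The line [(m, b)] is [y = m x + b]; the side of abscissa [x] is [Some x], and
   [None] is the side at infinity, which carries the slopes. *)
Definition height s l : F := if s is Some x then (l.1 * x + l.2)%R else l.1.

Lemma line_eq s t l l' :
  s != t -> height s l = height s l' -> height t l = height t l' -> l = l'.
Proof.
case: l l' => m b [m' b'].
have slope x : m = m' -> (m * x + b = m' * x + b' -> (m, b) = (m', b'))%R.
  by move=> -> /addrI->.
case: s t => [x|] [y|] //= xy; last first.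
- exact: slope.
- by move=> + mm; apply: slope.
move=> ex ey; apply: (slope x) => //.
have: ((m - m') * (x - y) = 0)%R.
  have -> : ((m - m') * (x - y) = (m * x + b) - (m * y + b)
             - ((m' * x + b') - (m' * y + b')))%R by ring.
  by rewrite ex ey subrr.
move/eqP; rewrite mulf_eq0 !subr_eq0 => /orP[/eqP//|/eqP xy'].
by rewrite xy' eqxx in xy.
Qed.

(** Lines of equal slope meet at infinity; the removed point is the common point of the vertical
    lines, so it lies on no line [(m, b)]. *)
Lemma lines_meet l l' : exists s, height s l = height s l'.
Proof.
case: l l' => m b [m' b']; have [->|mm] := eqVneq m m'; first by exists None.
exists (Some ((b' - b) / (m - m')))%R => /=.
have mm0 : (m - m' != 0)%R by rewrite subr_eq0.
by field.
Qed.

Lemma line_through s t y z :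
  s != t -> exists l, height s l = y /\ height t l = z.
Proof.
case: s t => [x|] [x'|] //= xx.
- have xx0 : (x - x' != 0)%R by rewrite subr_eq0.
  exists ((y - z) / (x - x'), y - (y - z) / (x - x') * x)%R => /=.
  by split; field.
- by exists (z, y - z * x)%R; split=> //=; ring.
- by exists (y, z - y * x')%R; split=> //=; ring.
Qed.

Definition pencil s y : {set line} := [set l | height s l == y].

(** A line of the pencil is determined by its height on any other side. *)
Lemma card_pencil s y : #|pencil s y| <= #|F|.
Proof.
have [t st] : exists t : pside, s != t.
  by case: s => [x|]; [exists None | exists (Some 0%R)].
rewrite -(card_in_imset (f := height t)) ?max_card // => l l'.
by rewrite !inE => /eqP sl /eqP sl'; apply: (line_eq st); rewrite sl sl'.
Qed.

(* The edge [L] of the header is the line [(0, 0)], so that [p_s] has height 0. *)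
Let l0 : line := (0, 0)%R.

Lemma height_l0 s : height s l0 = 0%R.
Proof. by case: s => //= x; rewrite mul0r addr0. Qed.

(** Off [l0] the [pick] succeeds by [lines_meet], with a unique result by [line_eq], so [None] is
    the colour of [l0] alone. *)
Definition colour l : side :=
  if l == l0 then None else [pick s | height s l == 0%R].

Lemma colourP s l : l != l0 -> (colour l == Some s) = (height s l == 0%R).
Proof.
move=> l_neq0; rewrite /colour (negbTE l_neq0); case: pickP => [t /eqP tl|->//].
apply/eqP/eqP => [[<-]//|sl]; congr Some; apply/eqP; apply: contraNT l_neq0.
by move=> ts; apply/eqP/(line_eq ts); rewrite height_l0.
Qed.

(* On the side [Some s], [Some (Some y)] is the point of height [y] and
   [Some None] the new vertex; the side [None] carries the colours. *)
Definition line_edge l : {set side * side} :=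
  transversal_edge (fun i : side =>
    if i is Some s then Some (Some (height s l)) else colour l).

Definition new_edge s : {set side * side} :=
  transversal_edge (fun i : side =>
    if i is Some t then Some (if t == s then None else Some 0%R) else Some s).

Definition plane_hypergraph : {set {set side * side}} :=
  line_edge @: setT :|: new_edge @: setT.

Lemma plane_hypergraph_transversal e :
  e \in plane_hypergraph -> exists f, e = transversal_edge f.
Proof. by case/setUP => /imsetP[x _ ->]; eexists. Qed.

(** If [l] meets [l0] on a side other than [s], that point is still in [new_edge s]; otherwise [l]
    has colour [s]. *)
Lemma line_new_edge_meet l s : line_edge l :&: new_edge s != set0.
Proof.
have [->|l_neq0] := eqVneq l l0.
  have [t ts] : exists t : pside, t != s.
    by case: s => [x|]; [exists None | exists (Some 0%R)].
  apply: (transversal_edge_meet (i := Some t)).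
  by rewrite (negbTE ts) height_l0.
have [t] := lines_meet l l0; rewrite height_l0 => tl.
have [ts|ts] := eqVneq t s.
  apply: (transversal_edge_meet (i := None)).
  by apply/eqP; rewrite colourP // -ts tl.
by apply: (transversal_edge_meet (i := Some t)); rewrite (negbTE ts) tl.
Qed.

Lemma new_edges_meet s s' : new_edge s :&: new_edge s' != set0.
Proof.
have [->|ss'] := eqVneq s s'; first exact: (transversal_edge_meet (i := None)).
have [t /andP[ts ts']] : exists t : pside, (t != s) && (t != s').
  apply/existsP; apply: contraT; rewrite negb_exists => /forallP Dss'.
  (* A third side exists, as there are [#|F| + 1 >= 3] of them. *)
  suff: #|pside| <= 2 by rewrite card_option ltnNge (card_finNzRing_gt1 F).
  have <- : #|[set s; s']| = 2 by rewrite cards2 ss'.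
  rewrite -cardsT; apply/subset_leq_card/subsetP => t _.
  by have := Dss' t; rewrite negb_and !negbK !inE.
by apply: (transversal_edge_meet (i := Some t)); rewrite (negbTE ts) (negbTE ts').
Qed.

Lemma plane_hypergraph_meet e f :
  e \in plane_hypergraph -> f \in plane_hypergraph -> e :&: f != set0.
Proof.
case/setUP => /imsetP[x _ ->] /setUP[] /imsetP[y _ ->].
- have [s xy] := lines_meet x y.
  by apply: (transversal_edge_meet (i := Some s)); rewrite xy.
- exact: line_new_edge_meet.
- by rewrite setIC; apply: line_new_edge_meet.
- exact: new_edges_meet.
Qed.

(** * Lower bound on the size of covers *)

Definition lines_on (v : side * side) : {set line} := [set l | v \in line_edge l].

Lemma lines_on_point s y : lines_on (Some s, Some (Some y)) = pencil s y.
Proof. by apply/setP => l; rewrite !inE in_transversal_edge. Qed.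

Definition is_point (v : side * side) : bool :=
  if v is (Some _, Some (Some _)) then true else false.

(** New vertices lie on no line, the class of colour [Some s] is contained in [pencil s 0] without
    [l0], and that of colour [None] in the singleton of [l0]. *)
Lemma card_lines_on_nonpoint v : ~~ is_point v -> #|lines_on v| < #|F|.
Proof.
have F1 := card_finNzRing_gt1 F; have F0 := ltnW F1.
case: v => -[s|] c vP.
  suff -> : lines_on (Some s, c) = set0 by rewrite cards0.
  apply/setP => l; rewrite !inE in_transversal_edge /=.
  by apply: contraNF vP => /eqP<-.
case: c {vP} => [s|].
  apply: leq_trans (card_pencil s 0%R).
  rewrite (cardsD1 l0 (pencil _ _)) inE height_l0 eqxx ltnS.
  apply/subset_leq_card/subsetP => l; rewrite !inE in_transversal_edge /=.
  have [->|l_neq0] := eqVneq l l0; first by rewrite /colour eqxx.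
  by rewrite colourP.
apply: leq_ltn_trans F1; rewrite -(cards1 l0).
apply/subset_leq_card/subsetP => l; rewrite !inE in_transversal_edge /=.
apply: contraLR => l_neq0.
have [s] := lines_meet l l0; rewrite height_l0 => /eqP.
by rewrite -(colourP _ l_neq0) => /eqP->.
Qed.

Lemma card_lines_on v : #|lines_on v| <= #|F|.
Proof.
case vP: (is_point v); last by rewrite ltnW ?card_lines_on_nonpoint ?vP.
by case: v vP => -[s|] [[y|]|] // _; rewrite lines_on_point card_pencil.
Qed.

Lemma plane_hypergraph_cover_gt C :
  is_vertex_cover plane_hypergraph C -> #|F| < #|C|.
Proof.
move=> /forall_inP coverC.
have hit e : e \in plane_hypergraph -> exists2 v, v \in C & v \in e.
  by move=> /coverC/set0Pn[v /setIP[vC ve]]; exists v.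
have cover_lines : \bigcup_(v in C) lines_on v = setT.
  apply/setP => l; rewrite in_setT; apply/bigcupP.
  have [|v vC vl] := hit (line_edge l); first by rewrite inE imset_f.
  by exists v; rewrite ?inE.
have card_lines : #|[set: line]| = #|F| * #|F| by rewrite cardsT card_prod.
rewrite ltnNge; apply/negP => CF.
(* At most [#|F|] vertices cover [#|F| * #|F|] lines, which leaves no room for a deficit anywhere in
   [C]. *)
have heavy (D : {set side * side}) :
    D \subset C -> #|F| * #|D| <= #|\bigcup_(v in D) lines_on v|.
  move=> DC; rewrite leqNgt; apply/negP.
  move=> /(ltn_card_bigcup card_lines_on DC).
  by rewrite cover_lines card_lines ltn_mul2l [_ < #|C|]ltnNge CF andbF.
have C_points v : v \in C -> is_point v.
  move=> vC; apply: contraT => /card_lines_on_nonpoint; rewrite ltnNge.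
  by have := heavy [set v]; rewrite sub1set cards1 muln1 big_set1 => ->.
have [|v vC _] := hit (line_edge l0); first by rewrite inE imset_f.
have := C_points v vC; case: v vC => -[s|] [[y|]|] // vC _.
(* As [new_edge s] has no old point on side [s], the point [w] of [C] on it lies on another side. *)
have [|w wC] := hit (new_edge s); first by rewrite inE imset_f ?orbT.
have := C_points w wC; case: w wC => -[t|] [[z|]|] // wC _.
rewrite in_transversal_edge /=; case: ifP => // /negbT ts _.
set v := (_, _) in vC; set w := (_, _) in wC.
have vw : v != w by apply: contraNneq ts => -[->].
have /heavy : [set v; w] \subset C by rewrite subUset !sub1set vC.
(* The line through [v] and [w] is counted twice, so this pair covers less than [2 * #|F|] lines,
   against [heavy]. *)
have [l [tl sl]] := line_through z y ts.
have : 0 < #|lines_on v :&: lines_on w|.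
  by apply/card_gt0P; exists l; rewrite inE !lines_on_point !inE sl tl !eqxx.
have := cardsUI (lines_on v) (lines_on w).
have := card_lines_on v; have := card_lines_on w.
by rewrite cards2 vw bigcup_setU !big_set1; lia.
Qed.

Lemma nu_plane_hypergraph : nu plane_hypergraph = 1.
Proof.
apply: nu_eq1 plane_hypergraph_meet.
by apply/set0Pn; exists (line_edge l0); rewrite inE imset_f.
Qed.

Lemma tau_plane_hypergraph : tau plane_hypergraph = #|F|.+1.
Proof.
(* The cover is the side at infinity with its new vertex, [y = None]. *)
apply: (tau_eq (C := [set (Some None : side, Some y : side) | y : pside])).
- apply/forall_inP => _ /setUP[] /imsetP[x _ ->]; apply/set0Pn.
    exists (Some None, Some (Some (height None x))).
    by rewrite inE in_transversal_edge eqxx andbT imset_f.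
  exists (Some None, Some (if None == x then None else Some 0%R)).
  by rewrite inE in_transversal_edge eqxx andbT imset_f.
- by rewrite card_imset ?card_option // => y z [].
- exact: plane_hypergraph_cover_gt.
Qed.

Lemma ryser_plane_hypergraph : ryser (#|F| + 2) plane_hypergraph.
Proof.
have sideE : #|side| = #|F| + 2 by rewrite !card_option addn2.
have tr := plane_hypergraph_transversal; rewrite -sideE; split.
- exact: transversal_partite (None : side) _ tr.
- exact: transversal_uniform tr.
- by rewrite tau_plane_hypergraph nu_plane_hypergraph sideE addn2 muln1 subn1.
Qed.

End Construction.

Theorem corollary1p4 (q : nat) (hq : prime_power q) :
  exists (V : finType) (H : {set {set V}}), intersecting H /\ ryser (q + 2) H.
Proof.
have [p [k [p_prime k_gt0 ->]]] := hq.
have [F _ <-] := pPrimePowerField p_prime k_gt0.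
exists _, (plane_hypergraph F); split; first exact: nu_plane_hypergraph.
exact: ryser_plane_hypergraph.
Qed.
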